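(* Let $k\ge2$ and let $Z_k=\operatorname{Tot}\mathcal O_{\mathbb P^1}(-k)$, with charts $U,V$ as in the context. Let $\eta\in\mathrm H^0(Z_k,\Lambda^2\mathcal T_{Z_k})$ be the Poisson structure given by $(zu\,\partial_z\wedge\partial_u,\,-\zeta v\,\partial_\zeta\wedge\partial_v)$ and let $\theta\in\mathrm H^1(Z_k,\mathcal T_{Z_k})$ be represented by a $1$-cocycle $\sum_{i=1}^{k-1}t_iz^{-k+i}\,\partial_u$ with $t_i\in\mathbb C$. There exists no simultaneous deformation of the pair $$\eta\oplus\theta\in\mathrm H^0(Z_k,\Lambda^2\mathcal T_{Z_k})\oplus\mathrm H^1(Z_k,\mathcal T_{Z_k})\simeq\mathrm{HH}^2(Z_k)$$ restricting to the purely noncommutative deformation (the deformation quantization of $\eta$) and to the purely commutative deformation (the classical deformation given by $\theta$) described in the context.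
   Context: $Z_k$ is the total space of the line bundle $\mathcal O_{\mathbb P^1}(-k)$ over $\mathbb C$, covered by $U=\{(z,u)\in\mathbb C^2\}$ and $V=\{(\zeta,v)\in\mathbb C^2\}$ with $(\zeta,v)=(z^{-1},z^ku)$ on $W=U\cap V\simeq\mathbb C^*\times\mathbb C$; $\mathcal T_{Z_k}$ is its tangent sheaf and $\mathrm{HH}^\bullet(Z_k)$ its Hochschild cohomology. The restriction $\mathcal O_{Z_k}|_{\mathfrak U}$ of the structure sheaf to $\mathfrak U=(U\leftarrow W\to V)$ is the diagram $$\mathbb C[z,u]\xrightarrow{\ \phi_0\ }\mathbb C[z^{\pm1},u]\xleftarrow{\ \psi_0\ }\mathbb C[\zeta,v],\qquad \phi_0(z)=z,\ \phi_0(u)=u,\ \psi_0(\zeta)=z^{-1},\ \psi_0(v)=z^ku,$$ with commutative multiplications $\mu_0,\nu_0,\xi_0$ on $\mathcal O_{Z_k}(U)=\mathbb C[z,u]$, $\mathcal O_{Z_k}(V)=\mathbb C[\zeta,v]$, $\mathcal O_{Z_k}(W)=\mathbb C[z^{\pm1},u]$ respectively. A formal deformation of this diagram consists of associative $\mathbb C[[\epsilon]]$-bilinear multiplications $\mu_0+\epsilon\mu_1+\cdots$, $\nu_0+\epsilon\nu_1+\cdots$, $\xi_0+\epsilon\xi_1+\cdots$ on the three algebras of power series in $\epsilon$ over $\mathbb C[z,u]$, $\mathbb C[\zeta,v]$, $\mathbb C[z^{\pm1},u]$, together with $\mathbb C[[\epsilon]]$-linear maps $\phi_0+\epsilon\phi_1+\cdots$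 and $\psi_0+\epsilon\psi_1+\cdots$ that are multiplicative for the deformed multiplications. The multiplications are the component in $\mathrm C^{0,2}$ and the maps the component in $\mathrm C^{1,1}$ of the degree-two part $\mathrm C^{0,2}\oplus\mathrm C^{1,1}$ of the Gerstenhaber–Schack complex of the diagram, where $\mathrm C^{0,2}$ is the space of triples of bilinear maps $A\otimes A\to A$ for $A=\mathcal O_{Z_k}(U),\mathcal O_{Z_k}(V),\mathcal O_{Z_k}(W)$ and $\mathrm C^{1,1}=\operatorname{Hom}(\mathcal O_{Z_k}(U),\mathcal O_{Z_k}(W))\oplus\operatorname{Hom}(\mathcal O_{Z_k}(V),\mathcal O_{Z_k}(W))$. Purely noncommutative deformation: the morphisms $\phi_0,\psi_0$ are undeformed, and $\mu_n=B_n^U$, $\nu_n=B_n^V$, $\xi_n=B_n^W$ are the bidifferential operators of a deformation quantization of $\eta$, i.e. star products $f\star g=fg+\sum_{n\ge1}\epsilon^nB_n(f,g)$ compatible with $\phi_0,\psi_0$, where $U\simeq\mathbb C^2$ carries the Kontsevich star product associated to $zu\,\partial_z\wedge\partial_u$ and $B_1$ is the Poisson bracket of $\eta$: $B_1^U(z^au^b,z^cu^d)=(ad-bc)z^{a+c}u^{b+d}$, $B_1^V(\zeta^av^b,\zeta^cv^d)=-(ad-bc)\zeta^{a+c}v^{b+d}$. Purely commutative deformation: the multiplications $\mu_0,\nu_0,\xi_0$ are undeformed, $\phi=\phi_0$, and $\psi=\psi_0+\epsilon\psi_1+\epsilon^2\psi_2+\cdots$ is given by $$\psi(\zeta^mv^n)=(z^{-1})^m\Big(z^ku+\epsilon\sum_{i=1}^{k-1}t_iz^i\Big)^n,$$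 corresponding to the deformed change of coordinates $(\zeta,v)=\big(z^{-1},z^ku+\epsilon\sum_{i=1}^{k-1}t_iz^i\big)$. The paper explains the meaning of the statement as follows: in the solution space of the Maurer–Cartan equation governing deformations of the diagram, the purely noncommutative and purely commutative deformations are curves $C_1$ and $C_2$, lying in $\mathrm C^{0,2}$ and $\mathrm C^{1,1}$ with tangent vectors $\eta$ and $\theta$ respectively, and there cannot exist a curve in the solution space with tangent $\eta\oplus\theta$ projecting to $C_1\subset\mathrm C^{0,2}$ and $C_2\subset\mathrm C^{1,1}$.
   Formalization: The cocycle θ is assumed nonzero, i.e. some t_i ≠ 0 with 1 ≤ i ≤ k−1; when all t_i = 0 the purely noncommutative deformation of η is itself a simultaneous deformation, so the claim fails there. *)

(* Defs.v *)
From HB Require Import structures.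
From mathcomp Require Import all_boot all_order all_algebra.
From mathcomp Require Import perm complex finmap.
From mathcomp Require Import all_classical all_reals all_analysis.
From mathcomp Require Import -(notations) monalg.

Set Implicit Arguments.
Unset Strict Implicit.
Unset Printing Implicit Defensive.

Import Order.TTheory GRing.Theory Num.Theory.

Local Open Scope ring_scope.
Local Open Scope complex_scope.

(* The coordinate rings below are monoid algebras C[K] of additive commutative
   monoids K of exponents: C[z, u] and C[zeta, v] are C[N x N], and C[z^{+-1}, u]
   is C[Z x N].  The library only gives [malg] a ring structure when K has no
   nontrivial units, which rules out Z, so the convolution product is
   defined here; the module structure is the one of the library. *)
Notation algebra R K := (@malg K (R[i])).
Notation polyalg R := (algebra R (nat * nat)%type).
Notation laurentalg R := (algebra R (int * nat)%type).

Section Algebras.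
Variable R : realType.

Definition mon {K : choiceType} (a : K) (c : R[i]) : algebra R K :=
  mkmalgU a c.

Definition linext {K : choiceType} {V : lmodType R[i]} (h : K -> V)
    (f : algebra R K) : V :=
  \sum_(a <- msupp f) mcoeff a f *: h a.

Definition amul {K : nmodType} (f g : algebra R K) : algebra R K :=
  linext (fun a : K => linext (fun b : K => mon (a + b : K) 1) g) f.

Definition aone {K : nmodType} : algebra R K := mon 0 1.

(* Coordinates are indexed by bool: false for z (or zeta), true for u (or v). *)
Definition dp (i : bool) : polyalg R -> polyalg R :=
  linext (fun a => if i then mon (a.1, a.2.-1) a.2%:R
                   else mon (a.1.-1, a.2) a.1%:R).

Definition dl (i : bool) : laurentalg R -> laurentalg R :=
  linext (fun a => if i then mon (a.1, a.2.-1) a.2%:R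
                   else mon (a.1 - 1, a.2) a.1%:~R).

Definition phi0 : polyalg R -> laurentalg R :=
  linext (fun a => mon (a.1%:Z, a.2) 1).

Definition psi0 (k : nat) : polyalg R -> laurentalg R :=
  linext (fun a => mon ((k * a.2)%:Z - a.1%:Z, a.2) 1).

Definition bidifferential {K : nmodType} (d : bool -> algebra R K -> algebra R K)
    (B : algebra R K -> algebra R K -> algebra R K) : Prop :=
  exists (N : nat) (c : nat -> nat -> nat -> nat -> algebra R K), forall f g,
    B f g = \sum_(i < N) \sum_(j < N) \sum_(p < N) \sum_(q < N)
      amul (c i j p q)
        (amul (iter i (d false) (iter j (d true) f))
              (iter p (d false) (iter q (d true) g))).

(* Poisson bracket of the bivector  p d_0 /\ d_1. *)
Definition poisson {K : nmodType} (d : bool -> algebra R K -> algebra R K)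
    (p f g : algebra R K) : algebra R K :=
  amul p (amul (d false f) (d true g) - amul (d true f) (d false g)).

Definition eta_U : polyalg R := mon (1%N, 1%N) 1.
Definition eta_V : polyalg R := mon (1%N, 1%N) (- 1).
Definition eta_W : laurentalg R := mon (1, 1%N) 1.

(* The vector field  sum_(1 <= i < k) t_i z^(i - k) d_u  on W. *)
Definition theta (k : nat) (t : nat -> R[i]) (f : laurentalg R) : laurentalg R :=
  amul (\sum_(1 <= i < k) mon (i%:Z - k%:Z, 0%N) (t i)) (dl true f).

End Algebras.

(* Power series in epsilon over A are sequences nat -> A; [ext1] and [ext2] are
   the C[[epsilon]]-(bi)linear extensions of sum_n epsilon^n f_n. *)
Definition ext1 {A B : nmodType} (f : nat -> A -> B) (F : nat -> A) : nat -> B :=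
  fun n => \sum_(i < n.+1) f i (F (n - i)%N).

Definition ext2 {A B C : nmodType} (m : nat -> A -> B -> C)
    (F : nat -> A) (G : nat -> B) : nat -> C :=
  fun n => \sum_(i < n.+1) \sum_(j < (n - i).+1) m i (F j) (G (n - i - j)%N).

Definition at_order0 {T : Type} {A : nmodType} (m : T -> A) (n : nat) (x : T) : A :=
  if n is 0 then m x else 0.

Definition at_order0_2 {T T' : Type} {A : nmodType} (m : T -> T' -> A)
    (n : nat) (x : T) (y : T') : A :=
  if n is 0 then m x y else 0.

(* Kontsevich's formula (Deformation quantization of Poisson manifolds, section 2) in R^2 for the bivector zu d_z /\ d_u.  For Gamma with n
   vertices of the first type, [inl j] is the vertex j, [inr false] and [inr true]
   are the vertices L and R, and (j, b) is the b-th edge starting at j. *)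
Notation graph n := ({ffun 'I_n * bool -> 'I_n + bool}) (only parsing).
Notation labelling n := ({ffun 'I_n * bool -> bool}) (only parsing).

Section Kontsevich.
Variable R : realType.

Section Graph.
Variable n : nat.

Definition admissible (G : graph n) : bool :=
  [forall j, [&& G (j, false) != G (j, true), G (j, false) != inl j
               & G (j, true) != inl j]].

Variable G : graph n.

(* Partial derivatives of phi(p, q) = Arg((q - p) / (q - conj p)) along the real
   and imaginary part of p, resp. of q: d Arg(a + ib) = (a db - b da)/(a^2 + b^2),
   for a + ib = q - p and a + ic = q - conj p. *)
Definition dangle_src (p q : R * R) (y : bool) : R :=
  let a := q.1 - p.1 in let b := q.2 - p.2 in let c := q.2 + p.2 in
  if y then - a / (a ^+ 2 + b ^+ 2) - a / (a ^+ 2 + c ^+ 2)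
  else b / (a ^+ 2 + b ^+ 2) - c / (a ^+ 2 + c ^+ 2).

Definition dangle_tgt (p q : R * R) (y : bool) : R :=
  let a := q.1 - p.1 in let b := q.2 - p.2 in let c := q.2 + p.2 in
  if y then a / (a ^+ 2 + b ^+ 2) - a / (a ^+ 2 + c ^+ 2)
  else - b / (a ^+ 2 + b ^+ 2) + c / (a ^+ 2 + c ^+ 2).

Definition position (p : seq (R * R)) (x : 'I_n + bool) : R * R :=
  match x with
  | inl j => nth (0, 0) p j
  | inr false => (0, 0)
  | inr true => (1, 0)
  end.

Definition jacobian (p : seq (R * R)) (e x : 'I_n * bool) : R :=
  let src := nth (0, 0) p e.1 in let tgt := position p (G e) in
  (if e.1 == x.1 then dangle_src src tgt x.2 else 0)
  + (if G e == inl x.1 then dangle_tgt src tgt x.2 else 0).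

(* Density of /\_j (d phi_(j, false) /\ d phi_(j, true)) with respect to
   dx_0 dy_0 ... dx_(n-1) dy_(n-1).  Rows and columns of the Jacobian have the same
   finite index type, so that its determinant needs no choice of ordering. *)
Definition angle_form (p : seq (R * R)) : R :=
  \sum_(s : {perm 'I_n * bool}) (-1) ^+ s * \prod_e jacobian p e (s e).

Definition upper_configuration (p : seq (R * R)) : bool :=
  all (fun x => 0 < x.2) p && uniq p.

End Graph.

Fixpoint integral_plane_pow (n : nat) (F : seq (R * R) -> R) : R :=
  if n is n'.+1 then
    (\int[lebesgue_measure]_(x in setT) \int[lebesgue_measure]_(y in setT)
      integral_plane_pow n' (fun p => F ((x, y) :: p)))%R
  else F [::].

Definition weight (n : nat) (G : graph n) : R :=
  (n`!%:R * (2 * pi) ^+ (2 * n))^-1 *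
  integral_plane_pow n (fun p => if upper_configuration p then angle_form G p else 0).

Definition alpha (i j : bool) : polyalg R :=
  match i, j with
  | false, true => eta_U R
  | true, false => - eta_U R
  | _, _ => 0
  end.

Definition derive_into (n : nat) (G : graph n)
    (I : labelling n) (x : 'I_n + bool) (f : polyalg R) : polyalg R :=
  foldr (fun e h => if G e == x then dp (I e) h else h) f (enum {: 'I_n * bool}).

Definition graph_operator (n : nat) (G : graph n)
    (f g : polyalg R) : polyalg R :=
  \sum_(I : labelling n)
    amul (\big[@amul R _/aone R]_(j < n)
            derive_into G I (inl j) (alpha (I (j, false)) (I (j, true))))
      (amul (derive_into G I (inr false) f) (derive_into G I (inr true) g)).

Definition kontsevich (n : nat) (f g : polyalg R) : polyalg R :=
  \sum_(G : graph n | admissible G)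
    (weight G)%:C *: graph_operator G f g.

End Kontsevich.

Section Deformations.
Variable R : realType.

Record C02 := MkC02 {
  mulU : {bilinear polyalg R -> polyalg R -> polyalg R};
  mulV : {bilinear polyalg R -> polyalg R -> polyalg R};
  mulW : {bilinear laurentalg R -> laurentalg R -> laurentalg R} }.

Record C11 := MkC11 {
  mapU : {linear polyalg R -> laurentalg R};
  mapV : {linear polyalg R -> laurentalg R} }.

Record gs_curve := GSCurve { muls : nat -> C02; maps : nat -> C11 }.

Definition eqC02 (M N : C02) : Prop :=
  [/\ mulU M =2 mulU N, mulV M =2 mulV N & mulW M =2 mulW N].

Definition eqC11 (M N : C11) : Prop := mapU M =1 mapU N /\ mapV M =1 mapV N.

Definition starU (D : gs_curve) := ext2 (fun n => mulU (muls D n) : _ -> _ -> _).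
Definition starV (D : gs_curve) := ext2 (fun n => mulV (muls D n) : _ -> _ -> _).
Definition starW (D : gs_curve) := ext2 (fun n => mulW (muls D n) : _ -> _ -> _).
Definition morU (D : gs_curve) := ext1 (fun n => mapU (maps D n) : _ -> _).
Definition morV (D : gs_curve) := ext1 (fun n => mapV (maps D n) : _ -> _).

Definition is_deformation (k : nat) (D : gs_curve) : Prop :=
  [/\ [/\ mulU (muls D 0) =2 @amul R _, mulV (muls D 0) =2 @amul R _
        & mulW (muls D 0) =2 @amul R _],
      mapU (maps D 0) =1 @phi0 R /\ mapV (maps D 0) =1 @psi0 R k,
      [/\ forall F G H, starU D (starU D F G) H = starU D F (starU D G H),
          forall F G H, starV D (starV D F G) H = starV D F (starV D G H)
        & forall F G H, starW D (starW D F G) H = starW D F (starW D G H)],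
      forall F G, morU D (starU D F G) = starW D (morU D F) (morU D G)
    & forall F G, morV D (starV D F G) = starW D (morV D F) (morV D G)].

Definition purely_noncommutative (k : nat) (D : gs_curve) : Prop :=
  [/\ is_deformation k D,
      forall n, mapU (maps D n) =1 at_order0 (@phi0 R) n /\
                mapV (maps D n) =1 at_order0 (@psi0 R k) n,
      forall n, [/\ bidifferential (@dp R) (mulU (muls D n)),
                    bidifferential (@dp R) (mulV (muls D n))
                  & bidifferential (@dl R) (mulW (muls D n))],
      [/\ mulU (muls D 1) =2 poisson (@dp R) (eta_U R),
          mulV (muls D 1) =2 poisson (@dp R) (eta_V R)
        & mulW (muls D 1) =2 poisson (@dl R) (eta_W R)]
    & forall n, mulU (muls D n) =2 @kontsevich R n].

Definition smul (F G : nat -> laurentalg R) : nat -> laurentalg R :=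
  ext2 (at_order0_2 (@amul R _)) F G.

Definition sconst (f : laurentalg R) : nat -> laurentalg R :=
  fun n => if n is 0 then f else 0.

Definition spow (F : nat -> laurentalg R) (m : nat) : nat -> laurentalg R :=
  iter m (smul F) (sconst (aone R)).

(* z^k u + epsilon * sum_(1 <= i < k) t_i z^i *)
Definition deformed_v (k : nat) (t : nat -> R[i]) (n : nat) : laurentalg R :=
  match n with
  | 0 => mon (k%:Z, 1%N) 1
  | 1 => \sum_(1 <= i < k) mon (i%:Z, 0%N) (t i)
  | _ => 0
  end.

Definition purely_commutative (k : nat) (t : nat -> R[i]) (D : gs_curve) : Prop :=
  [/\ forall n, [/\ mulU (muls D n) =2 at_order0_2 (@amul R _) n,
                    mulV (muls D n) =2 at_order0_2 (@amul R _) n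
                  & mulW (muls D n) =2 at_order0_2 (@amul R _) n],
      forall n, mapU (maps D n) =1 at_order0 (@phi0 R) n
    & forall a b n, mapV (maps D n) (mon (a, b) 1) =
        smul (spow (sconst (mon (- 1, 0%N) 1)) a) (spow (deformed_v k t) b) n].

(* eta (+) theta as a Gerstenhaber-Schack cochain: the Poisson brackets of eta in
   C^{0,2}, and the pair (0, theta o psi_0) in C^{1,1}. *)
Definition has_tangent (k : nat) (t : nat -> R[i]) (D : gs_curve) : Prop :=
  [/\ mulU (muls D 1) =2 poisson (@dp R) (eta_U R),
      mulV (muls D 1) =2 poisson (@dp R) (eta_V R),
      mulW (muls D 1) =2 poisson (@dl R) (eta_W R),
      mapU (maps D 1) =1 (fun=> 0)
    & mapV (maps D 1) =1 theta k t \o @psi0 R k].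

Definition simultaneous_deformation (k : nat) (t : nat -> R[i])
    (D : gs_curve) : Prop :=
  is_deformation k D /\ has_tangent k t D.

Definition restricts_to (D D1 D2 : gs_curve) : Prop :=
  forall n, eqC02 (muls D n) (muls D1 n) /\ eqC11 (maps D n) (maps D2 n).

End Deformations.

(* Main.v *)
From HB Require Import structures.
Require Import Defs.
From mathcomp Require Import all_boot all_order all_algebra.
From mathcomp Require Import complex finmap.
From mathcomp Require Import all_classical all_reals all_analysis.
From mathcomp Require Import -(notations) monalg.

Import Order.TTheory GRing.Theory Num.Theory.
Local Open Scope ring_scope.
Local Open Scope complex_scope.

(** Compare [psi] on [zeta * v] and [v * zeta] at order epsilon^2.  The second
    order products [nu_2] and [xi_2] are intertwined by [psi_0], because the
    undeformed [psi_0] is multiplicative for the quantization, so they cancel;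
    [psi_2] only enters through commutative products, so it cancels in the
    commutator.  What remains is
      psi_1 (nu_1 (zeta, v) - nu_1 (v, zeta))
        = {z^-1, psi_1 v} + {psi_1 zeta, z^k u} - {z^k u, psi_1 zeta} - {psi_1 v, z^-1}.
    Here [psi_1 zeta = 0], and [psi_1 v] is a Laurent polynomial in [z], so it
    Poisson-commutes with [z^-1]; but the left-hand side is
    [- 2 psi_1 (zeta v) = - 2 sum_i t_i z^(i-1)], which is nonzero. *)

Section FreeModules.
Variables (R : realType) (K : choiceType) (V : lmodType R[i]) (h : K -> V).

(** Coefficients vanish off the support. This lets sums for several elements be written over one
    common index set, as linearity of [linext] requires. *)
Lemma linext_widen (f : algebra R K) (d : {fset K}) :
  fsubset (msupp f) d -> linext h f = \sum_(a <- d) mcoeff a f *: h a.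
Proof.
move=> fd; rewrite /linext (big_fset_incl _ fd) // => a _.
by move/mcoeff_outdom => ->; rewrite scale0r.
Qed.

Lemma linext_mon (a : K) (c : R[i]) : linext h (mon a c) = c *: h a.
Proof.
by rewrite (linext_widen _ _ msuppU_le) big_seq_fset1 mcoeffUU.
Qed.

Lemma linext_is_linear : linear (linext h).
Proof.
move=> c f g.
pose d := fsetU (msupp (c *: f + g)) (fsetU (msupp f) (msupp g)).
rewrite (linext_widen _ d) ?fsubsetUl //.
rewrite (linext_widen f d); last first.
  by rewrite (fsubset_trans (fsubsetUl _ _) (fsubsetUr _ _)).
rewrite (linext_widen g d); last first.
  by rewrite (fsubset_trans (fsubsetUr _ _) (fsubsetUr _ _)).
rewrite scaler_sumr -big_split; apply: eq_bigr => a _ /=.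
by rewrite mcoeffD mcoeffZ scalerDl scalerA.
Qed.

HB.instance Definition _ :=
  GRing.isLinear.Build R[i] (algebra R K) V *:%R (linext h) linext_is_linear.

End FreeModules.

Section Algebras.
Variable R : realType.

Lemma mon_scale (K : choiceType) (a : K) (c d : R[i]) :
  c *: mon a d = mon a (c * d).
Proof. by apply/malgP => b; rewrite mcoeffZ !mcoeffU mulrnAr. Qed.

Section Product.
Variable K : nmodType.
Implicit Types f g : algebra R K.

Lemma amul_mon (a b : K) (c d : R[i]) :
  amul (mon a c) (mon b d) = mon (a + b) (c * d).
Proof. by rewrite /amul !linext_mon !mon_scale mulr1. Qed.

Lemma amulE f g : amul f g =
  \sum_(a <- msupp f) \sum_(b <- msupp g) mon (a + b) (mcoeff a f * mcoeff b g).
Proof.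
apply: eq_bigr => a _; rewrite scaler_sumr.
by apply: eq_bigr => b _; rewrite !mon_scale mulr1.
Qed.

Lemma amulC f g : amul f g = amul g f.
Proof.
rewrite !amulE exchange_big; apply: eq_bigr => b _; apply: eq_bigr => a _.
by rewrite mulrC addrC.
Qed.

Lemma amul0l g : amul 0 g = 0.
Proof. exact: raddf0. Qed.

Lemma amul0r f : amul f 0 = 0.
Proof. by rewrite amulC amul0l. Qed.

Lemma amul_suml (I : Type) (r : seq I) (P : pred I) (F : I -> algebra R K) g :
  amul (\sum_(i <- r | P i) F i) g = \sum_(i <- r | P i) amul (F i) g.
Proof. exact: raddf_sum. Qed.

End Product.

Lemma dl_true_mon0 (a : int) (c : R[i]) : dl true (mon (a, 0%N) c) = 0.
(* The truncated exponent [0.-1] does no harm: its coefficient [0%:R] kills the term. *)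
Proof. by rewrite /dl linext_mon mon_scale mulr0 [mon _ 0]monalgU0. Qed.

Lemma theta_mon (k : nat) (t : nat -> R[i]) (a : int) :
  theta k t (mon (a, 1%N) 1) =
    \sum_(1 <= i < k) mon (i%:Z - k%:Z + a, 0%N) (t i).
Proof.
rewrite /theta /dl linext_mon scale1r amul_suml.
by apply: eq_bigr => i _; rewrite amul_mon mulr1.
Qed.

Lemma theta_mon0 (k : nat) (t : nat -> R[i]) (a : int) (c : R[i]) :
  theta k t (mon (a, 0%N) c) = 0.
Proof. by rewrite /theta dl_true_mon0 amul0r. Qed.

Lemma psi0_mon (k : nat) (a : nat * nat) :
  psi0 k (mon a 1) = mon ((k * a.2)%:Z - a.1%:Z, a.2) 1 :> laurentalg R.
Proof. by rewrite /psi0 linext_mon scale1r. Qed.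

Lemma poisson_zeta_v :
  poisson (@dp R) (eta_V R) (mon (1%N, 0%N) 1) (mon (0%N, 1%N) 1) =
    - mon (1%N, 1%N) 1.
Proof.
rewrite /poisson /dp !linext_mon /= !scale1r !amul_mon !mulr1 /eta_V.
by rewrite mul0r [mon (_ + _) 0]monalgU0 subr0 amul_mon mulr1 -[RHS]monalgUN.
Qed.

Lemma poisson_v_zeta :
  poisson (@dp R) (eta_V R) (mon (0%N, 1%N) 1) (mon (1%N, 0%N) 1) =
    mon (1%N, 1%N) 1.
Proof.
rewrite /poisson /dp !linext_mon /= !scale1r !amul_mon !mulr1 /eta_V.
by rewrite mul0r [mon (_ + _) 0]monalgU0 sub0r -monalgUN amul_mon mulrNN mulr1.
Qed.

(** Each term of the bracket contains a [u]-derivative of one of the arguments. *)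
Lemma poisson_u_free (p f g : laurentalg R) :
  dl true f = 0 -> dl true g = 0 -> poisson (@dl R) p f g = 0.
Proof. by rewrite /poisson => -> ->; rewrite amul0r amul0l subrr amul0r. Qed.

End Algebras.

Arguments amulC {R K} f g.
Arguments poisson_u_free {R p f g}.

(** Constant series turn the identities imposed on all power series into relations between the
    coefficient maps. *)
Definition const_series {A : nmodType} (x : A) (n : nat) : A :=
  if n is 0 then x else 0.

(** For [i < n] the map [f i] receives a coefficient of positive order, which is 0. *)
Lemma ext1_const (A B : nmodType) (f : nat -> A -> B) (x : A) (n : nat) :
  (forall i, f i 0 = 0) -> ext1 f (const_series x) n = f n x.
Proof.
move=> f0; rewrite /ext1 big_ord_recr /= subnn big1 => [|i _]; first by rewrite add0r.
by have := ltn_ord i; rewrite -subn_gt0; case: (n - i)%N => //= m _; apply: f0.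
Qed.

Lemma ext2_const (A B C : nmodType) (m : nat -> A -> B -> C) (x : A) (y : B)
    (n : nat) :
  (forall i b, m i 0 b = 0) -> (forall i a, m i a 0 = 0) ->
  ext2 m (const_series x) (const_series y) n = m n x y.
Proof.
move=> m0l m0r; rewrite /ext2 big_ord_recr /= subnn big_ord1 big1 => [|i _].
  by rewrite add0r.
apply: big1 => -[[|j] j_le] _ /=; last exact: m0l.
by rewrite subn0; have := ltn_ord i; rewrite -subn_gt0; case: (n - i)%N.
Qed.

Lemma ext1_order2 (A B : nmodType) (f : nat -> A -> B) (F : nat -> A) :
  ext1 f F 2%N = f 0%N (F 2%N) + f 1%N (F 1%N) + f 2%N (F 0%N).
Proof. by rewrite /ext1 !big_ord_recr big_ord0 /= add0r. Qed.

Lemma ext2_order2 (A B C : nmodType) (m : nat -> A -> B -> C)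
    (F : nat -> A) (G : nat -> B) :
  ext2 m F G 2%N =
  m 0%N (F 0%N) (G 2%N) + m 0%N (F 1%N) (G 1%N) + m 0%N (F 2%N) (G 0%N)
  + (m 1%N (F 0%N) (G 1%N) + m 1%N (F 1%N) (G 0%N)) + m 2%N (F 0%N) (G 0%N).
Proof. by rewrite /ext2 !big_ord_recr !big_ord0 /= !add0r. Qed.

(** This is the coefficient of epsilon^2 in multiplicativity, evaluated on the constant series [f]
    and [g]. *)
Lemma morV_order2 (R : realType) (D : gs_curve R) (f g : polyalg R) :
  (forall F G, morV D (starV D F G) = starW D (morV D F) (morV D G)) ->
  let nu n := mulV (muls D n) in
  let xi n := mulW (muls D n) in
  let psi n := mapV (maps D n) in
  psi 0%N (nu 2%N f g) + psi 1%N (nu 1%N f g) + psi 2%N (nu 0%N f g) =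
  xi 0%N (psi 0%N f) (psi 2%N g) + xi 0%N (psi 1%N f) (psi 1%N g)
  + xi 0%N (psi 2%N f) (psi 0%N g)
  + (xi 1%N (psi 0%N f) (psi 1%N g) + xi 1%N (psi 1%N f) (psi 0%N g))
  + xi 2%N (psi 0%N f) (psi 0%N g).
Proof.
move=> psiM /=.
move/(congr1 (@^~ 2%N)): (psiM (const_series f) (const_series g)).
rewrite /morV ext1_order2 /starW ext2_order2.
have nu_const i : starV D (const_series f) (const_series g) i = mulV (muls D i) f g.
  by apply: ext2_const => *; [exact: linear0l | exact: linear0r].
have psi_const x i :
    ext1 (fun n => mapV (maps D n) : _ -> _) (const_series x) i = mapV (maps D i) x.
  by apply: ext1_const => *; exact: linear0.
by rewrite !nu_const !psi_const.
Qed.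

Arguments morV_order2 {R D} f g.

(** Bookkeeping for the commutator: [x], [x'] stand for the xi_2 terms, [y] for psi_2 of the
    commutative product, [a], [b], [c] for the three xi_0 terms, which reverse order when the
    arguments are swapped, and [p], [q] for the first-order brackets. *)
Lemma subr_cancel (V : zmodType) (x x' y a b c p p' q q' : V) :
  x + p + y = a + b + c + q + x -> x' + p' + y = c + b + a + q' + x' ->
  p - p' = q - q'.
Proof.
have cancel u w v : u + w + y = v + u -> w = v - y.
  by rewrite -addrA addrC => /addIr <-; rewrite addrK.
move=> /cancel -> /cancel ->.
have -> : c + b + a = a + b + c by rewrite -addrA addrC (addrC b).
by rewrite opprB addrA subrK opprD addrACA subrr add0r.
Qed.

Lemma morV_commutator (R : realType) (k : nat) (D : gs_curve R) (f g : polyalg R) :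
  is_deformation k D ->
  let nu n := mulV (muls D n) in
  let xi n := mulW (muls D n) in
  let psi n := mapV (maps D n) in
  (forall x y, psi 0%N (nu 2%N x y) = xi 2%N (psi 0%N x) (psi 0%N y)) ->
  psi 1%N (nu 1%N f g) - psi 1%N (nu 1%N g f) =
  (xi 1%N (psi 0%N f) (psi 1%N g) + xi 1%N (psi 1%N f) (psi 0%N g))
  - (xi 1%N (psi 0%N g) (psi 1%N f) + xi 1%N (psi 1%N g) (psi 0%N f)).
Proof.
move=> defD /= psi0M; have [[_ nu0 xi0] _ _ _ psiM] := defD.
have := morV_order2 f g psiM; have := morV_order2 g f psiM => /=.
rewrite !psi0M !nu0 !xi0 (amulC g f) => E' E.
(* Commutativity brings the xi_0 terms of the swapped identity to the reversed list [c + b + a]. *)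
move: E'; rewrite (amulC _ (mapV (maps D 2) f)) (amulC (mapV (maps D 1) g)).
by rewrite (amulC (mapV (maps D 2) g)); apply: subr_cancel E.
Qed.

Theorem proposition5p20 (R : realType) (k : nat) (t : nat -> R[i])
    (Dnc Dc : gs_curve R) :
  (2 <= k)%N ->
  (exists2 i : nat, (1 <= i < k)%N & t i != 0) ->
  purely_noncommutative k Dnc ->
  purely_commutative k t Dc ->
  ~ exists D : gs_curve R,
      simultaneous_deformation k t D /\ restricts_to D Dnc Dc.
Proof.
move=> _ [i0 /andP[i0_gt0 i0_lt_k] ti0] [ncD nc_maps _ _ _] _ [D [[defD tanD] resD]].
have [_ [_ psi0E] _ _ _] := defD.
have [_ nu1 xi1 _ psi1] := tanD.
have [_ _ _ _ ncM] := ncD.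
(* The second-order products of [D] are those of [Dnc], whose maps vanish beyond order 0, so the
   order 2 identity of [Dnc] collapses to this one. *)
have psi0M f g : mapV (maps D 0) (mulV (muls D 2) f g) =
    mulW (muls D 2) (mapV (maps D 0) f) (mapV (maps D 0) g).
  have [[_ -> ->] _] := resD 2%N.
  have := morV_order2 f g ncM => /=.
  have [_ p0] := nc_maps 0%N; have [_ p1] := nc_maps 1%N.
  have [_ p2] := nc_maps 2%N.
  by rewrite !(p0, p1, p2) /= !(linear0r, linear0l, addr0, add0r) !psi0E.
pose zeta : polyalg R := mon (1%N, 0%N) 1; pose v : polyalg R := mon (0%N, 1%N) 1.
have psi1_zeta : mapV (maps D 1) zeta = 0.
  by rewrite psi1 /= psi0_mon theta_mon0.
have dpsi1_v : dl true (mapV (maps D 1) v) = 0.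
  rewrite psi1 /= psi0_mon theta_mon /dl raddf_sum big1 // => i _.
  exact: dl_true_mon0.
have dpsi0_zeta : dl true (mapV (maps D 0) zeta) = 0.
  by rewrite psi0E psi0_mon dl_true_mon0.
have := morV_commutator _ _ _ zeta v defD psi0M => /=.
rewrite psi1_zeta linear0l linear0r !nu1 poisson_zeta_v poisson_v_zeta !xi1.
rewrite (poisson_u_free dpsi0_zeta dpsi1_v).
rewrite (poisson_u_free dpsi1_v dpsi0_zeta).
(* Here [w] is psi_1 of [- zeta v] and [w'] is psi_1 of [zeta v], so the left side is [- 2 w']. *)
set w := mapV _ _; set w' := mapV _ _.
have -> : w = - w' by exact: linearN.
rewrite !addr0 subr0 -opprD => /eqP; rewrite oppr_eq0.
rewrite {}/w' psi1 /= psi0_mon theta_mon.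
(* As psi_0 sends [zeta v] to z^(k-1) u, the term of [t i] in [w'] has exponent (i - k) + (k - 1) =
   i - 1. Only [i0] contributes to this coefficient, which is therefore 2 t_(i0), nonzero in
   characteristic 0. *)
move=> /eqP/(congr1 (mcoeff (i0%:Z - 1, 0%N))).
rewrite mcoeff0 mcoeffD raddf_sum /= -mulr2n => /eqP.
rewrite mulrn_eq0 /= (bigD1_seq i0) ?iota_uniq ?mem_index_iota ?i0_gt0 //=.
rewrite muln1 addrA subrK mcoeffUU big1 ?addr0 ?(negPf ti0) // => i i_neq.
rewrite addrA subrK mcoeffU xpair_eqE andbT (inj_eq (addIr _)) eqz_nat.
by rewrite (negPf i_neq).
Qed.
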